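(* Let $I$ be a monomial ideal of $S=K[t_1,\ldots,t_s]$, let $I=\bigcap_{i=1}^m\mathfrak{q}_i$ be its irreducible decomposition, and let $\mathcal{Q}(I)$ be the covering polyhedron of $I$. The following hold. (a) If $\mathfrak{q}_k=(t_1^{b_1},\ldots,t_r^{b_r})$, $b_\ell\geq 1$ for all $\ell$, and ${\rm rad}(\mathfrak{q}_j)\not\subset{\rm rad}(\mathfrak{q}_k)$ for all $j\neq k$, then the vector $b^{-1}:=\sum_{i=1}^rb_i^{-1}e_i$ is a vertex of $\mathcal{Q}(I)$. (b) If $I$ has no embedded associated primes and ${\rm rad}(\mathfrak{q}_j)\neq{\rm rad}(\mathfrak{q}_i)$ for $j\neq i$, then there are $\alpha_1,\ldots,\alpha_m$ in $\mathbb{N}^s\setminus\{0\}$ such that $\mathfrak{q}_i=\mathfrak{q}_{\alpha_i}$ and $\alpha_i^{-1}$ is a vertex of $\mathcal{Q}(I)$ for $i=1,\ldots,m$.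
   Context: $K$ is a field, $\mathbb{N}=\{0,1,\ldots\}$, $t^a=t_1^{a_1}\cdots t_s^{a_s}$ for $a\in\mathbb{N}^s$, $e_i$ is the $i$-th unit vector of $\mathbb{R}^s$; vector inequalities are componentwise and $1$ also denotes $(1,\ldots,1)$. Monomial ideals are nonzero and proper. If $I$ is minimally generated by the monomials $t^{v_1},\ldots,t^{v_q}$ and $A$ is the $s\times q$ matrix with columns $v_1,\ldots,v_q$, the covering polyhedron of $I$ is $\mathcal{Q}(I)=\{x\in\mathbb{R}^s\mid x\geq 0;\ xA\geq 1\}$ ($x$ a row vector). For $b=(b_1,\ldots,b_s)\in\mathbb{N}^s\setminus\{0\}$, set $\mathfrak{q}_b:=(\{t_i^{b_i}\mid b_i\geq 1\})$ and $b^{-1}:=\sum_{b_i\geq 1}b_i^{-1}e_i$. The irreducible decomposition of $I$ is the unique (up to order) expression $I=\mathfrak{q}_1\cap\cdots\cap\mathfrak{q}_m$ where each $\mathfrak{q}_i$ is an ideal of the form $\mathfrak{q}_{\alpha}$ with $\alpha\in\mathbb{N}^s\setminus\{0\}$ and $I\neq\bigcap_{i\neq j}\mathfrak{q}_i$ for $j=1,\ldots,m$. *)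

(* Defs.v *)
From HB Require Import structures.
From mathcomp Require Import all_boot all_order all_algebra.
From mathcomp Require Import mpoly.
From mathcomp Require Import boolp classical_sets reals.

Set Implicit Arguments.
Unset Strict Implicit.
Unset Printing Implicit Defensive.

Import Order.TTheory GRing.Theory Num.Theory.

Local Open Scope classical_set_scope.
Local Open Scope ring_scope.

Section Ideals.
Variable A : comNzRingType.
Implicit Types I J P : set A.

(* The unit ideal is allowed, unlike in mathcomp's [idealr_closed]. *)
Definition is_ideal I : Prop :=
  [/\ I 0, forall f g, I f -> I g -> I (f + g)
    & forall a f, I f -> I (a * f)].

Definition ideal_gen (G : set A) : set A := smallest is_ideal G.

Definition radical I : set A := [set f | exists n : nat, I (f ^+ n)].

Definition prime_ideal P : Prop :=
  [/\ is_ideal P, ~ P 1 & forall f g, P (f * g) -> P f \/ P g].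

Definition colon I (f : A) : set A := [set g | I (g * f)].

(* Associated primes of the module A / I: the annihilators of classes of A / I
   that are prime. *)
Definition associated_prime I P : Prop :=
  prime_ideal P /\ exists f, P = colon I f.

Definition embedded_prime I P : Prop :=
  associated_prime I P /\ exists P', associated_prime I P' /\ P' `<` P.

End Ideals.

Section MonomialIdeals.
Variables (K : fieldType) (s : nat).
Implicit Types (I : set {mpoly K[s]}) (M : set 'X_{1..s}) (b : 'X_{1..s}).

Definition monomials_ideal M : set {mpoly K[s]} :=
  ideal_gen [set 'X_[K, a] | a in M].

Definition monomial_ideal I : Prop := exists M, I = monomials_ideal M.

(* Irredundancy also forces the exponents v 0, ..., v (n-1) to be distinct. *)
Definition minimally_generated I (n : nat) (v : 'I_n -> 'X_{1..s}) : Prop :=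
  I = monomials_ideal (range v) /\
  forall j, I <> monomials_ideal [set v i | i in [set i | i <> j]].

Definition irr_ideal b : set {mpoly K[s]} :=
  ideal_gen [set 'X_i ^+ b i | i in [set i : 'I_s | (1 <= b i)%N]].

Definition irreducible_decomposition I (m : nat)
    (q : 'I_m -> set {mpoly K[s]}) : Prop :=
  [/\ forall i, exists2 a : 'X_{1..s}, a != 0%MM & q i = irr_ideal a,
      I = \bigcap_i q i
    & forall j, I <> \bigcap_(i in [set i | i <> j]) q i].

End MonomialIdeals.

Section Polyhedra.
Variables (R : realType) (s : nat).
Implicit Types (P F : set 'rV[R]_s).

Definition exponent_matrix (n : nat) (v : 'I_n -> 'X_{1..s}) : 'M[R]_(s, n) :=
  \matrix_(i, j) (v j i)%:R.

Definition covering_polyhedron (n : nat) (v : 'I_n -> 'X_{1..s}) :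
    set 'rV[R]_s :=
  [set x : 'rV[R]_s | (forall i, 0 <= x 0 i) /\
           (forall j, 1 <= (x *m exponent_matrix v) 0 j)].

Definition hyperplane (c : 'rV[R]_s) (beta : R) : set 'rV[R]_s :=
  [set x : 'rV[R]_s | \sum_i c 0 i * x 0 i = beta].

Definition halfspace (c : 'rV[R]_s) (beta : R) : set 'rV[R]_s :=
  [set x : 'rV[R]_s | beta <= \sum_i c 0 i * x 0 i].

Definition proper_face P F : Prop :=
  [/\ F !=set0, F <> P
    & exists c beta,
        [/\ c != 0, P `<=` halfspace c beta & F = P `&` hyperplane c beta]].

Definition vertex P (x : 'rV[R]_s) : Prop := proper_face P [set x].

Definition inv_exponent (b : 'X_{1..s}) : 'rV[R]_s :=
  \sum_(i < s | (1 <= b i)%N) (b i)%:R^-1 *: delta_mx 0 i.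

End Polyhedra.

Arguments irr_ideal K {s} b.
Arguments exponent_matrix R {s n} v.
Arguments covering_polyhedron R {s n} v.
Arguments inv_exponent R {s} b.

(* Main.v *)
Require Import Defs.
From HB Require Import structures.
From mathcomp Require Import all_boot all_order all_algebra.
From mathcomp Require Import mpoly.
From mathcomp Require Import boolp classical_sets reals.

Import Order.TTheory GRing.Theory Num.Theory.

Local Open Scope classical_set_scope.
Local Open Scope ring_scope.

(** A component q_b of minimal radical contributes a vertex because b^{-1} is
    cut out by tight inequalities of the covering polyhedron.  Let B be the support of b.

    - The generators of I lie in q_b, so each t^v has v_i >= b_i >= 1 for some
      i in B; hence b^{-1} satisfies every inequality <v, x> >= 1.
    - Minimality of the radical of q_b among the radicals means that every other
      component has a support that leaves B.  For i in B, the monomial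
      t_i^{b_i} times a high power of the variables outside B therefore lies in
      every component, hence in I, and a generator t^v dividing it has to agree
      with b_i e_i on B ([isolating_generator]).
    - These generators, together with the inequalities x_l >= 0 for l outside
      B, are tight at b^{-1} and at no other point of the polyhedron
      ([vertex_covering_polyhedron]).  The sum of the corresponding supporting
      functionals exposes b^{-1} ([vertex_of_supporting]).

    For a decomposition without embedded primes whose components have distinct
    radicals, the minimality condition on supports is automatic: every
    component of an irredundant decomposition has an associated prime as its
    radical ([associated_radical]), so an inclusion between the radicals of two
    distinct components would be strict and exhibit an embedded prime.

    On the algebraic side everything reduces to exponents: membership in a
    monomial ideal is decided monomial by monomial ([monomials_idealP]). *)

(** * Ideals and radicals *)

Lemma ideal_gen_ideal {A : comNzRingType} (G : set A) : is_ideal (ideal_gen G).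
Proof.
split=> [J [[J0 _ _] _] //|f g If Ig J JG|a f If J JG].
  by have [[_ JD _] _] := JG; apply: JD; [apply: If | apply: Ig].
by have [[_ _ JM] _] := JG; apply: JM; apply: If.
Qed.

Lemma ideal_sum {A : comNzRingType} (I : set A) (T : Type) (r : seq T)
    (P : pred T) (F : T -> A) :
  is_ideal I -> (forall i, P i -> I (F i)) -> I (\sum_(i <- r | P i) F i).
Proof. by move=> [I0 ID _] IF; apply: (big_ind I). Qed.

Lemma radical_ideal {A : comNzRingType} (I : set A) :
  is_ideal I -> is_ideal (radical I).
Proof.
move=> idI; have [I0 ID IM] := idI.
split=> [|f g [k If] [l Ig]|a f [k If]].
- by exists 1%N; rewrite expr1.
- exists (k + l)%N; rewrite exprDn; apply: ideal_sum => // i _.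
  rewrite -mulr_natl; apply: (IM _ _); have [li | il] := leqP l i.
    by rewrite -(subnK li) exprD mulrA; apply: IM.
  by rewrite -addnBA 1?ltnW // exprD -mulrA mulrC; apply: IM.
- by exists k; rewrite exprMn; apply: IM.
Qed.

(** * Membership in monomial ideals *)

(** The polynomials all of whose monomials are divisible by a monomial of M form
    an ideal, which gives one direction; conversely a polynomial is the sum of
    its terms. *)
Lemma monomials_idealP {K : fieldType} {s : nat} (M : set 'X_{1..s})
    (f : {mpoly K[s]}) :
  @monomials_ideal K s M f <->
  forall m, m \in msupp f -> exists2 a, M a & (a <= m)%MM.
Proof.
split=> [|Mf].
  move: f; apply: smallest_sub.
    split=> [m|f g Jf Jg m /msuppD_le|g f Jf m /msuppM_le/allpairsP].
    - by rewrite msupp0.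
    - by rewrite mem_cat => /orP[/Jf|/Jg].
    - move=> [[m1 m2] /= [_ /Jf [a Ma am] ->]]; exists a => //.
      by apply: (lepm_trans am); apply: lem_addl.
  move=> _ [a Ma <-] m; rewrite msuppX inE => /eqP ->.
  by exists a; rewrite ?lepm_refl.
rewrite [f]mpolyE big_seq; apply: ideal_sum => [|m /Mf [a Ma am]].
  exact: ideal_gen_ideal.
rewrite -mul_mpolyC -(submK am) mpolyXD mulrA.
have [_ _] := ideal_gen_ideal [set 'X_[K, a] | a in M]; apply.
by apply: sub_gen_smallest; exists a.
Qed.

Lemma irr_ideal_monomials (K : fieldType) {s : nat} (b : 'X_{1..s}) :
  irr_ideal K b =
  @monomials_ideal K s [set (U_(i) *+ b i)%MM | i in [set i | (1 <= b i)%N]].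
Proof.
rewrite /irr_ideal /monomials_ideal image_comp; congr (ideal_gen _).
by apply: eq_imagel => i _ /=; rewrite mpolyXn.
Qed.

Lemma irr_idealP {K : fieldType} {s : nat} (b : 'X_{1..s}) (f : {mpoly K[s]}) :
  irr_ideal K b f <->
  forall m, m \in msupp f -> exists i, (1 <= b i <= m i)%N.
Proof.
rewrite irr_ideal_monomials monomials_idealP.
split=> Mf m /Mf.
  move=> [_ [i b1 <-] /mnm_lepP/(_ i)].
  by rewrite mulmnE mnm1E eqxx mul1n => bm; exists i; apply/andP.
move=> [i /andP[b1 bm]]; exists (U_(i) *+ b i)%MM; first by exists i.
apply/mnm_lepP => l; rewrite mulmnE mnm1E.
by case: eqP => [<-|_]; rewrite ?mul1n.
Qed.

Lemma irr_idealX {K : fieldType} {s : nat} (b m : 'X_{1..s}) :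
  irr_ideal K b 'X_[m] <-> exists i, (1 <= b i <= m i)%N.
Proof.
rewrite irr_idealP msuppX; split=> [|bm _ /[1!inE] /eqP -> //].
by apply; rewrite inE.
Qed.

(** * Radicals of irreducible monomial ideals *)

(** The exponent whose irreducible ideal is generated by the variables in the
    support of [b], that is, the radical of the irreducible ideal of [b]. *)
Definition support_exponent {s : nat} (b : 'X_{1..s}) : 'X_{1..s} :=
  [multinom ((1 <= b i)%N : nat) | i < s].

Lemma support_exponent_gt0 {s : nat} (b : 'X_{1..s}) (i : 'I_s) :
  (1 <= support_exponent b i)%N = (1 <= b i)%N.
Proof. by rewrite mnmE lt0b. Qed.

Lemma irr_ideal_supportP {K : fieldType} {s : nat} (b : 'X_{1..s})
    (f : {mpoly K[s]}) :
  irr_ideal K (support_exponent b) f <->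
  forall m, m \in msupp f -> exists i, (1 <= b i)%N && (1 <= m i)%N.
Proof.
rewrite irr_idealP; split=> Pf m /Pf [i /andP[]].
  by move=> b1 /(leq_trans b1) m1; exists i; rewrite -support_exponent_gt0 b1.
by move=> bi mi; exists i; rewrite mnmE bi mi.
Qed.

(** This ideal is the kernel of the substitution sending the variables in the
    support of [b] to 0 and fixing the others, whose target is a domain. *)
Lemma prime_irr_ideal_support (K : fieldType) {s : nat} (b : 'X_{1..s}) :
  prime_ideal (irr_ideal K (support_exponent b)).
Proof.
pose h i : {mpoly K[s]} := if (1 <= b i)%N then 0 else 'X_i.
pose phi := mmap (@mpolyC s K) h.
have idP : is_ideal (irr_ideal K (support_exponent b)).
  exact: ideal_gen_ideal.
have h0 (m : 'X_{1..s}) i : (1 <= b i)%N -> (1 <= m i)%N -> mmap1 h m = 0.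
  move=> bi mi; rewrite /mmap1 (bigD1 i) //= /h bi expr0n.
  by rewrite eqn0Ngt mi mul0r.
have phi0 f : irr_ideal K (support_exponent b) f <-> phi f = 0.
  split=> [/irr_ideal_supportP Pf|f0].
    rewrite /phi /mmap big_seq big1 // => m /Pf [i /andP[bi mi]].
    by rewrite (h0 m i) // mulr0.
  (* f = f - phi f, and substitution changes a monomial only if it is already
     in the ideal. *)
  rewrite -[f]subr0 -f0 /phi /mmap {1}[f]mpolyE -sumrB.
  apply: ideal_sum => // m _; rewrite -mul_mpolyC -mulrBr.
  have [_ _] := idP; apply.
  have [[i /andP[bi mi]] | bm] :=
    pselect (exists i, (1 <= b i)%N && (1 <= m i)%N).
    rewrite (h0 m i) // subr0; apply/irr_ideal_supportP => m'.
    by rewrite msuppX inE => /eqP ->; exists i; rewrite bi.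
  suff -> : mmap1 h m = 'X_[m] by rewrite subrr; case: idP.
  rewrite mpolyXE_id; apply: eq_bigr => i _; rewrite /h.
  case: ifP => // bi; case mi : (m i) => [//|k].
  by case: bm; exists i; rewrite bi mi.
split=> //.
  by rewrite phi0 /phi rmorph1; apply/eqP; apply: oner_neq0.
move=> f g; rewrite !phi0 /phi rmorphM => /eqP; rewrite mulf_eq0.
by case/orP => /eqP; [left|right].
Qed.

Lemma radical_irr_ideal (K : fieldType) {s : nat} (b : 'X_{1..s}) :
  radical (irr_ideal K b) = irr_ideal K (support_exponent b).
Proof.
have [_ P1 PM] := prime_irr_ideal_support K b.
apply/seteqP; split=> [f [k]|].
  have sub : irr_ideal K b `<=` irr_ideal K (support_exponent b).
    move=> g /irr_idealP Ig; apply/irr_ideal_supportP => m /Ig [i /andP[bi bm]].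
    by exists i; rewrite bi (leq_trans bi bm).
  move/sub; elim: k => [|k IHk]; first by rewrite expr0.
  by rewrite exprS => /PM [].
apply: smallest_sub => [|_ [i bi <-]].
  exact/radical_ideal/ideal_gen_ideal.
exists (b i); rewrite /= support_exponent_gt0 in bi.
have -> : support_exponent b i = 1%N by rewrite mnmE bi.
by rewrite expr1; apply: sub_gen_smallest; exists i.
Qed.

Lemma radical_irr_ideal_sub (K : fieldType) {s : nat} (a b : 'X_{1..s}) :
  (forall i, (1 <= a i)%N -> (1 <= b i)%N) ->
  radical (irr_ideal K a) `<=` radical (irr_ideal K b).
Proof.
move=> ab; rewrite !radical_irr_ideal => f /irr_ideal_supportP Pf.
apply/irr_ideal_supportP => m /Pf [i /andP[ai mi]].
by exists i; rewrite ab.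
Qed.

(** * Irredundant decompositions and associated primes *)

(** Dropping [q k] changes the intersection, and since the ideals are monomial
    the change is witnessed by a monomial of any polynomial witnessing it. *)
Lemma irredundant_monomial {K : fieldType} {s m : nat} {I : set {mpoly K[s]}}
    {q : 'I_m -> set {mpoly K[s]}} (k : 'I_m) :
  irreducible_decomposition I q ->
  exists2 u : 'X_{1..s}, (forall j, j <> k -> q j 'X_[u]) & ~ q k 'X_[u].
Proof.
move=> [qa Iq irr]; apply: contrapT => nu; apply: (irr k).
rewrite Iq; apply/seteqP; split=> [f If j _|f If j _]; first exact: If.
have [->|/eqP jk] := eqVneq j k; last exact: If.
have [a _ qk] := qa k; rewrite qk; apply/irr_idealP => u uf.
apply/(@irr_idealX K); rewrite -qk; apply: contrapT => nqk.
apply: nu; exists u => // i ik; have [ai _ qi] := qa i.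
rewrite qi; apply/irr_idealX; move: (If i ik); rewrite qi.
by move=> /irr_idealP; apply.
Qed.

(** The radical of [q k] is the annihilator modulo [I] of a monomial that lies
    in all the other components and is only one variable away from [q k]. *)
Lemma associated_radical {K : fieldType} {s m : nat} {I : set {mpoly K[s]}}
    {q : 'I_m -> set {mpoly K[s]}} (k : 'I_m) :
  irreducible_decomposition I q -> associated_prime I (radical (q k)).
Proof.
move=> dec; have [u qu nqu] := irredundant_monomial k dec.
have [qa Iq _] := dec; have [b b0 qk] := qa k.
have idq j : is_ideal (q j) by have [a _ ->] := qa j; apply: ideal_gen_ideal.
rewrite qk radical_irr_ideal; split; first exact: prime_irr_ideal_support.
(* Raising the exponents of u keeps the monomial in the other components; on
   the support of b, (b i).-1 is the largest exponent that stays outside q k,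
   so that one more factor 'X_i is exactly what is needed to enter it. *)
pose w : 'X_{1..s} :=
  [multinom (if (1 <= b i)%N then (b i).-1 else u i) | i < s].
have uw : (u <= w)%MM.
  apply/mnm_lepP => i; rewrite mnmE; case: ifP => // bi.
  rewrite -ltnS prednK // ltnNge; apply/negP => bu; apply: nqu.
  by rewrite qk; apply/irr_idealX; exists i; rewrite bi.
have qw j g : j <> k -> q j (g * 'X_[w]).
  move=> /qu qj; have [_ _ qM] := idq j.
  by rewrite -(submK uw) mpolyXD mulrA; apply: qM.
exists 'X_[w]; apply/seteqP; split=> [g /irr_ideal_supportP Pg|g].
  rewrite /colon /= Iq => j _.
  have [->|/eqP /qw//] := eqVneq j k.
  rewrite qk; apply/irr_idealP => e; rewrite (perm_mem (msuppMX _ _)).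
  move=> /mapP[e' /Pg [i /andP[bi e'i]] ->]; exists i.
  by rewrite bi mnmDE mnmE bi -(prednK bi) /= -addn1 leq_add2l.
rewrite /colon /= Iq => /(_ k Logic.I); rewrite qk => /irr_idealP Ig.
apply/irr_ideal_supportP => e eg.
have /Ig [i /andP[bi]] : (w + e)%MM \in msupp (g * 'X_[w]).
  by rewrite mcoeff_msupp mcoeffMX -mcoeff_msupp.
rewrite mnmDE mnmE bi => be; exists i; rewrite bi lt0n.
by apply: contraTneq be => ->; rewrite addn0 -ltnNge prednK.
Qed.

(** * Vertices of the covering polyhedron *)

(** A sum of terms, each at least [beta i], equals the sum of the [beta i] only
    if all terms are tight: so the sum of the supporting functionals exposes the
    intersection of their faces.  The second point of [P] ensures both that the
    face is proper and that the functionals do not sum to zero. *)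
Lemma vertex_of_supporting {R : realType} {s k : nat} {P : set 'rV[R]_s}
    {x : 'rV[R]_s} (c : 'I_k -> 'rV[R]_s) (beta : 'I_k -> R) :
  P x -> (exists2 y, P y & y <> x) ->
  (forall i, P `<=` halfspace (c i) (beta i)) ->
  (forall i, hyperplane (c i) (beta i) x) ->
  (forall y, P y -> (forall i, hyperplane (c i) (beta i) y) -> y = x) ->
  vertex P x.
Proof.
move=> Px [y Py yx] Pc xc xuniq.
have nP : [set x] <> P by move=> PE; apply: yx; move: Py; rewrite -PE.
have sumE z : \sum_j (\sum_i c i) 0 j * z 0 j = \sum_i \sum_j c i 0 j * z 0 j.
  rewrite exchange_big; apply: eq_bigr => j _.
  by rewrite summxE mulr_suml.
have faceE : [set x] = P `&` hyperplane (\sum_i c i) (\sum_i beta i).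
  apply/seteqP; split=> [_ ->|z [Pz]].
    by split=> //; rewrite /hyperplane /= sumE; apply: eq_bigr => i _; apply: xc.
  rewrite /hyperplane /= sumE => /eqP; rewrite -subr_eq0 -sumrB => /eqP z0.
  apply: xuniq => // i; apply/eqP; rewrite -subr_eq0; apply/eqP.
  apply: (psumr_eq0P _ z0) => // l _; rewrite subr_ge0.
  exact: (Pc l z Pz).
split=> //; first by exists x.
exists (\sum_i c i), (\sum_i beta i); split=> //.
  apply/eqP => c0; apply: nP; rewrite faceE setIidl // => z _.
  have : ([set x] : set 'rV[R]_s) x by [].
  rewrite faceE c0 => -[_]; rewrite /hyperplane /= => <-.
  by apply: eq_bigr => i _; rewrite !mxE !mul0r.
move=> z Pz; rewrite /halfspace /= sumE; apply: ler_sum => i _.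
exact: (Pc i z Pz).
Qed.

(** The inverse of 0 being 0, the formula also covers the coordinates outside
    the support of [b]. *)
Lemma inv_exponentE (R : realType) {s : nat} (b : 'X_{1..s}) (i : 'I_s) :
  inv_exponent R b 0 i = (b i)%:R^-1.
Proof.
rewrite /inv_exponent summxE; have [bi|] := boolP (1 <= b i)%N.
  rewrite (bigD1 i) //= big1 ?addr0 => [|l /andP[_ li]].
    by rewrite !mxE !eqxx mulr1.
  by rewrite !mxE eqxx eq_sym (negPf li) mulr0.
rewrite -eqn0Ngt => /eqP bi; rewrite bi invr0 big1 // => l bl.
have : l != i by apply: contraTneq bl => ->; rewrite bi.
by move=> li; rewrite !mxE eqxx eq_sym (negPf li) mulr0.
Qed.

Lemma covering_polyhedronE {R : realType} {s n : nat} (v : 'I_n -> 'X_{1..s})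
    (x : 'rV[R]_s) :
  covering_polyhedron R v x <->
  (forall i, 0 <= x 0 i) /\ (forall j, 1 <= \sum_i (v j i)%:R * x 0 i).
Proof.
have vE j : (x *m exponent_matrix R v) 0 j = \sum_i (v j i)%:R * x 0 i.
  by rewrite mxE; apply: eq_bigr => i _; rewrite mxE mulrC.
by split=> -[x0 x1]; split=> // j; move: (x1 j); rewrite vE.
Qed.

(** The hypotheses on [v] give one tight inequality per coordinate: for [i] in
    the support of [b], the generator that restricts to [b i] times the i-th
    unit vector there; for [i] outside, the sign condition on the i-th
    coordinate. On the polyhedron this triangular system has [b]^{-1} as its
    only solution. *)
Lemma vertex_covering_polyhedron (R : realType) {s n : nat}
    (v : 'I_n -> 'X_{1..s}) (b : 'X_{1..s}) :
  b != 0%MM ->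
  (forall j, exists i, (1 <= b i <= v j i)%N) ->
  (forall i, (1 <= b i)%N ->
     exists j, v j i = b i /\ forall l, l != i -> (1 <= b l)%N -> v j l = 0%N) ->
  vertex (covering_polyhedron R v) (inv_exponent R b).
Proof.
move=> b0 vb bv; set x := inv_exponent R b.
have xE i : x 0 i = (b i)%:R^-1 by rewrite /x inv_exponentE.
have x_ge0 i : 0 <= x 0 i by rewrite xE invr_ge0.
have Qx : covering_polyhedron R v x.
  apply/covering_polyhedronE; split=> // j; have [i /andP[bi bv_i]] := vb j.
  rewrite (bigD1 i) //= -[leLHS]addr0; apply: lerD.
    by rewrite xE ler_pdivlMr ?ltr0n // mul1r ler_nat.
  by apply: sumr_ge0 => l _; rewrite mulr_ge0.
have [i0 bi0] : exists i, (1 <= b i)%N.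
  apply: contrapT => nb; case/eqP: b0; apply/mnmP => i; rewrite mnm0E.
  by case bi : (b i) => [//|k]; case: nb; exists i; rewrite bi.
(* One supporting pair (functional, bound) for each coordinate. *)
have /choice [cb cbP] : forall i, exists cb : 'rV[R]_s * R,
    [/\ covering_polyhedron R v `<=` halfspace cb.1 cb.2,
        hyperplane cb.1 cb.2 x
      & if (1 <= b i)%N then
          cb.2 = 1 /\ cb.1 0 i = (b i)%:R /\
          forall l, l != i -> (1 <= b l)%N -> cb.1 0 l = 0
        else cb = (delta_mx 0 i, 0)].
  move=> i; case bi: (1 <= b i)%N.
    have [j [vi vl]] := bv i bi; exists (\row_l (v j l)%:R, 1); split=> //=.
    - move=> y /covering_polyhedronE [_ /(_ j)]; rewrite /halfspace /=.
      by move=> /le_trans; apply; apply: ler_sum => l _; rewrite mxE.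
    - rewrite /hyperplane /= (bigD1 i) //= big1 => [|l li].
        by rewrite mxE vi xE mulfV ?addr0 // pnatr_eq0 -lt0n.
      rewrite mxE xE; case bl : (b l) => [|k]; first by rewrite invr0 mulr0.
      by rewrite vl ?bl // mul0r.
    - split=> //; split; first by rewrite mxE vi.
      by move=> l li bl; rewrite mxE vl.
  have dE (y : 'rV[R]_s) : \sum_l delta_mx 0 i 0 l * y 0 l = y 0 i.
    rewrite (bigD1 i) //= big1 => [|l li]; first by rewrite mxE !eqxx mul1r addr0.
    by rewrite mxE eqxx (negPf li) mul0r.
  exists (delta_mx 0 i, 0); split=> //=.
    by move=> y /covering_polyhedronE [y0 _]; rewrite /halfspace /= dE.
  by rewrite /hyperplane /= dE xE; case: (b i) bi => [|//]; rewrite invr0.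
apply: (vertex_of_supporting (fun i => (cb i).1) (fun i => (cb i).2)) => //.
- exists (x + delta_mx 0 i0); last first.
    move=> /rowP/(_ i0)/eqP; rewrite !mxE !eqxx /= -subr_eq0 addrAC subrr add0r.
    by rewrite oner_eq0.
  have [_ xQ] := (covering_polyhedronE v x).1 Qx.
  have d0 i : 0 <= delta_mx 0 i0 0 i :> R by rewrite mxE; case: (_ && _).
  apply/covering_polyhedronE; split=> [i|j].
    by rewrite mxE addr_ge0.
  apply: (le_trans (xQ j)); apply: ler_sum => i _.
  by rewrite mxE mulrDr lerDl mulr_ge0.
- by move=> i; have [] := cbP i.
- by move=> i; have [] := cbP i.
(* The coordinates outside the support of b vanish; each remaining equation
   then involves a single unknown. *)
move=> y Qy yh; have y0 l : (1 <= b l)%N = false -> y 0 l = 0.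
  move=> bl; have [_ _] := cbP l; rewrite bl => cbl.
  move: (yh l); rewrite cbl /hyperplane /= (bigD1 l) //= big1 => [|e el].
    by rewrite mxE !eqxx mul1r addr0.
  by rewrite mxE eqxx (negPf el) mul0r.
apply/rowP => i; rewrite xE; case bi : (1 <= b i)%N; last first.
  by rewrite y0 //; case: (b i) bi => [|//]; rewrite invr0.
have [_ _] := cbP i; rewrite bi => -[c2 [ci cl]].
move: (yh i); rewrite /hyperplane /= c2 (bigD1 i) //= big1 => [|l li].
  rewrite ci addr0 => /(canRL (mulKf _)); rewrite pnatr_eq0 -lt0n mulr1.
  by apply.
case bl : (1 <= b l)%N; first by rewrite cl // mul0r.
by rewrite y0 // mulr0.
Qed.

(** * Generators isolating a coordinate *)

(** The generator is any one dividing t_i^{b_i} times a large power of the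
    variables outside the support of [b]: this monomial lies in [q k] through
    t_i^{b_i}, and in each other component through a variable that the
    hypothesis on radicals provides outside the support of [b]. The generator
    vanishes at the other indices of the support, so its own membership in
    [q k] can only come from the index [i], which forces the exponent [b i]. *)
Lemma isolating_generator {K : fieldType} {s n m : nat} {I : set {mpoly K[s]}}
    {v : 'I_n -> 'X_{1..s}} {q : 'I_m -> set {mpoly K[s]}} {k : 'I_m}
    {b : 'X_{1..s}} {i : 'I_s} :
  I = monomials_ideal (range v) -> irreducible_decomposition I q ->
  q k = irr_ideal K b ->
  (forall j, j <> k -> ~ (radical (q j) `<=` radical (q k))) ->
  (1 <= b i)%N ->
  exists j, v j i = b i /\ forall l, l != i -> (1 <= b l)%N -> v j l = 0%N.
Proof.
move=> Iv [qa Iq _] qk qmin bi.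
have /choice [a aP] : forall j, exists a : 'X_{1..s}, q j = irr_ideal K a.
  by move=> j; have [a _ qj] := qa j; exists a.
(* N is at least every exponent occurring in the decomposition. *)
pose N := (\sum_j mdeg (a j))%N.
pose w : 'X_{1..s} :=
  [multinom (if (1 <= b l)%N then ((l == i) * b i)%N else N) | l < s].
have /monomials_idealP/(_ w) : monomials_ideal (range v) ('X_[w] : {mpoly K[s]}).
  rewrite -Iv Iq => j _; have [->|/eqP jk] := eqVneq j k.
    rewrite qk; apply/irr_idealX; exists i.
    by rewrite mnmE bi eqxx mul1n leqnn.
  have [l [al bl]] : exists l, (1 <= a j l)%N /\ (1 <= b l)%N = false.
    apply: contrapT => nl; apply: (qmin j jk); rewrite aP qk.
    apply: radical_irr_ideal_sub => l al; apply: contrapT => /negP/negPf bl.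
    by apply: nl; exists l.
  rewrite aP; apply/irr_idealX; exists l; rewrite al mnmE bl /=.
  rewrite /N (bigD1 j) //= mdegE (bigD1 l) //= -addnA; exact: leq_addr.
rewrite msuppX inE eqxx => -[//|_ [j _ <-] /mnm_lepP vw].
have vl l : l != i -> (1 <= b l)%N -> v j l = 0%N.
  move=> li bl; move: (vw l); rewrite mnmE bl (negPf li) mul0n leqn0.
  by move/eqP.
exists j; split=> //.
have : q k 'X_[v j].
  have: I 'X_[v j].
    rewrite Iv; apply/monomials_idealP => e; rewrite msuppX inE => /eqP ->.
    by exists (v j); rewrite ?lepm_refl //; exists j.
  by rewrite Iq; apply.
rewrite qk => /irr_idealX [l /andP[bl bv]].
have li : l = i.
  apply/eqP; apply: contrapT => /negP li; move: bv; rewrite (vl l li bl).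
  by rewrite leqn0 eqn0Ngt bl.
move: bv (vw i); rewrite li mnmE bi eqxx mul1n => bv vb.
by apply/eqP; rewrite eqn_leq vb.
Qed.

Theorem theorem7p1 (R : realType) (K : fieldType) (s : nat)
    (I : set {mpoly K[s]})
    (I_monomial : monomial_ideal I)
    (I_nonzero : I <> [set 0])
    (I_proper : I <> [set: {mpoly K[s]}])
    (n : nat) (v : 'I_n -> 'X_{1..s})
    (I_gens : minimally_generated I v)
    (m : nat) (q : 'I_m -> set {mpoly K[s]})
    (I_dec : irreducible_decomposition I q) :
  (forall (k : 'I_m) (b : 'X_{1..s}),
      b != 0%MM -> q k = irr_ideal K b ->
      (forall j : 'I_m, j <> k -> ~ (radical (q j) `<=` radical (q k))) ->
      vertex (covering_polyhedron R v) (inv_exponent R b)) /\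
  ((forall P, ~ embedded_prime I P) ->
   (forall i j : 'I_m, j <> i -> radical (q j) <> radical (q i)) ->
   exists alpha : 'I_m -> 'X_{1..s},
     forall i : 'I_m,
       [/\ alpha i != 0%MM,
           q i = irr_ideal K (alpha i)
         & vertex (covering_polyhedron R v) (inv_exponent R (alpha i))]).
Proof.
have [Iv _] := I_gens; have [qa Iq _] := I_dec.
have isolated_vertex (k : 'I_m) (b : 'X_{1..s}) :
    b != 0%MM -> q k = irr_ideal K b ->
    (forall j : 'I_m, j <> k -> ~ (radical (q j) `<=` radical (q k))) ->
    vertex (covering_polyhedron R v) (inv_exponent R b).
  move=> b0 qk qmin; apply: vertex_covering_polyhedron => // [j|i bi].
    have: I 'X_[v j].
      rewrite Iv; apply/monomials_idealP => e; rewrite msuppX inE => /eqP ->.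
      by exists (v j); rewrite ?lepm_refl //; exists j.
    by rewrite Iq => /(_ k Logic.I); rewrite qk => /irr_idealX.
  exact: isolating_generator Iv I_dec qk qmin bi.
split=> // unmixed rad_inj.
have /choice [alpha alphaP] : forall i, exists a : 'X_{1..s},
    a != 0%MM /\ q i = irr_ideal K a.
  by move=> i; have [a a0 qi] := qa i; exists a.
exists alpha => i; have [a0 qi] := alphaP i; split=> //.
apply: (isolated_vertex i) => // j ji sub.
apply: (unmixed (radical (q i))); split; first exact: associated_radical I_dec.
exists (radical (q j)); split; first exact: associated_radical I_dec.
split=> // sub'; apply: (rad_inj i j ji).
exact/seteqP.
Qed.
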